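(* Let $T$ be a fixed edge-ordered tree. Then $sat_m(n,e_0+T)=O(1)$.
   Context: An edge-ordered graph is a finite simple graph together with a linear order on its edge set (usually given by an injective labeling $l:E\to\mathbb{N}$ or $l:E\to\mathbb{R}$). An edge-ordered graph $H$ contains $G$ (has a copy of $G$) if $G$ is isomorphic, by an isomorphism respecting the edge-order, to a subgraph of $H$ with the induced order; otherwise $H$ is $G$-free. An edge-ordered tree is an edge-ordered graph whose underlying graph is a tree. For an edge-ordered graph $G$, $e_0+G$ denotes the edge-ordered graph obtained from $G$ by adding a vertex-disjoint (isolated) edge $e_0$ whose label is smaller than all labels of $G$. $sat_m(n,G)$ is the minimum number of edges in a $G$-free edge-ordered graph $H$ on $n$ vertices such that adding to $H$ any missing edge, inserted at the beginning of the linear order (i.e. with a label smaller than all labels of $H$), creates a copy of $G$. Asymptotic notation is for $n\to\infty$ with $T$ fixed. *)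

(* Defs.v *)
From mathcomp Require Import all_boot.

Set Implicit Arguments.
Unset Strict Implicit.
Unset Printing Implicit Defensive.

(* A finite simple graph on the vertex type V, its edges being 2-element sets,
   with an injective labelling of the edges.  Only the order of the labels of
   the edges matters; the values of [label] off [edges] are irrelevant. *)
Record eograph (V : finType) := EOGraph {
  edges : {set {set V}};
  label : {set V} -> nat;
  edges_card2 : forall e, e \in edges -> #|e| = 2;
  label_inj : {in edges &, injective label}
}.

(* H has a copy of G: f is an order-respecting isomorphism from G onto the
   subgraph of H with vertex set f @: V and edge set {f @: e | e in edges G};
   the copy need not be induced. *)
Definition contains (V W : finType) (G : eograph V) (H : eograph W) : Prop :=
  exists f : V -> W,
    [/\ injective f,
        {in edges G, forall e : {set V}, f @: e \in edges H}
      & {in edges G &, forall e1 e2 : {set V},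
          (label H (f @: e1) < label H (f @: e2))
            = (label G e1 < label G e2)}].

Section AddFirst.
Variables (V : finType) (H : eograph V) (e : {set V}).

Definition add_first_edges := e |: edges H.
Definition add_first_label (f : {set V}) :=
  if f == e then 0 else (label H f).+1.

Lemma add_first_card2 (he : #|e| = 2) f : f \in add_first_edges -> #|f| = 2.
Proof. by case/setU1P=> [->|/edges_card2]. Qed.

Lemma add_first_inj : {in add_first_edges &, injective add_first_label}.
Proof.
move=> f g /setU1P hf /setU1P hg; rewrite /add_first_label.
case: (f =P e) hf => [->|nf] hf; case: (g =P e) hg => [->|ng] hg //.
by case: hf hg => // hf [] // hg [] /label_inj; apply.
Qed.

(* The new edge gets label 0 and all labels of H are shifted up by one. *)
Definition add_first (he : #|e| = 2) : eograph V :=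
  EOGraph (add_first_card2 he) add_first_inj.

End AddFirst.

Section AddTwoVertices.
Variables (V : finType) (G : eograph V).

Definition lift_edges : {set {set V + bool}} :=
  [set inl @: (e : {set V}) | e in edges G].
Definition lift_label (f : {set V + bool}) := label G (inl @^-1: f).

Lemma inl_preimK (e : {set V}) : inl @^-1: (inl @: e : {set V + bool}) = e.
Proof. by apply/setP=> x; rewrite inE mem_imset // => ? ? []. Qed.

Lemma lift_card2 f : f \in lift_edges -> #|f| = 2.
Proof.
case/imsetP=> e he ->; rewrite card_imset; last by move=> ? ? [].
exact: edges_card2 he.
Qed.

Lemma lift_inj : {in lift_edges &, injective lift_label}.
Proof.
move=> _ _ /imsetP[e he ->] /imsetP[f hf ->].
by rewrite /lift_label !inl_preimK => /label_inj->.
Qed.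

(* G together with two additional isolated vertices. *)
Definition add_two_vertices : eograph (V + bool)%type :=
  EOGraph lift_card2 lift_inj.

Definition e0 : {set V + bool} := [set inr false; inr true].

Lemma e0_card2 : #|e0| = 2.
Proof. by rewrite cards2. Qed.

(* e_0 + G *)
Definition e0_plus : eograph (V + bool)%type :=
  add_first add_two_vertices e0_card2.

End AddTwoVertices.

Definition adj (V : finType) (G : eograph V) : rel V :=
  [rel x y | [set x; y] \in edges G].

Definition is_tree (V : finType) (G : eograph V) : Prop :=
  [/\ 0 < #|V|,
      forall x y : V, connect (adj G) x y
    & forall c : seq V, ucycle (adj G) c -> size c < 3].

Definition saturated_m (V W : finType) (G : eograph V) (H : eograph W) : Prop :=
  ~ contains G H /\
  forall (e : {set W}) (he : #|e| = 2),
    e \notin edges H -> contains G (add_first H he).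

(* sat_m(n, G) = k.  Stated as a relation so that no junk value is needed for
   those G (without edges) for which the minimum does not exist. *)
Definition is_sat_m (V : finType) (n : nat) (G : eograph V) (k : nat) : Prop :=
  (exists2 H : eograph 'I_n, saturated_m G H & #|edges H| = k) /\
  (forall H : eograph 'I_n, saturated_m G H -> k <= #|edges H|).

(* Main.v *)
(* A graph H is saturated for e0 + T as soon as it has no copy of e0 + T and
   every non-edge of H avoids some copy of T in H.  Suppose that H has no copy
   of e0 + T and that its copies of T have no common vertex.  Then every pair
   meeting the isolated vertices of H avoids some copy of T, so H can be made
   saturated by adding edges, each at the beginning of the order, inside its
   non-isolated part; their number is bounded independently of n.

   Such an H is built as follows.  Let f = xy be the smallest edge of T.  Take a
   triangle on a_0, a_1, a_2 whose edges come first in the order, and hang at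
   each a_i (layer i) a copy of T/f, with the vertex x = y placed at a_i.  For
   every i there is a copy of T which maps f to a_i a_(i+1), the side of x in
   T - f to layer i and the side of y to layer i+1; these three copies have no
   common vertex.  A copy of T avoiding the triangle edges would stay in one
   layer, which has only |V(T)| - 1 vertices.  Hence every copy of T uses a
   triangle edge, whereas in a copy of e0 + T the part T cannot: its edges are
   disjoint from e0 and larger than e0, and any two triangle edges meet. *)

Require Import Defs.
From mathcomp Require Import all_boot zify.
From Stdlib Require Import Classical.

Set Implicit Arguments.
Unset Strict Implicit.
Unset Printing Implicit Defensive.

(** * Copies of T and greedy saturation *)

Definition is_copy (V W : finType) (G : eograph V) (H : eograph W)
    (f : V -> W) : Prop :=
  [/\ injective f,
      {in edges G, forall e : {set V}, f @: e \in edges H}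
    & {in edges G &, forall e1 e2 : {set V},
        (label H (f @: e1) < label H (f @: e2))
          = (label G e1 < label G e2)}].

Lemma is_copy_add_first (V W : finType) (G : eograph V) (H : eograph W)
    (f : V -> W) (e : {set W}) (he : #|e| = 2) :
  e \notin edges H -> is_copy G H f -> is_copy G (add_first H he) f.
Proof.
move=> eH [finj fE fL]; split=> // [e1 e1G|e1 e2 e1G e2G].
  by rewrite inE fE ?orbT.
have nE e' : e' \in edges G -> (f @: e' == e) = false.
  by move=> /fE He'; apply: contraNF eH => /eqP <-.
by rewrite /= /add_first_label !nE // ltnS fL.
Qed.

(** The inserted edge itself serves as the image of the isolated edge [e0]. *)
Lemma contains_e0_plus_add_first (V W : finType) (T : eograph V)
    (H : eograph W) (f : V -> W) (e : {set W}) (he : #|e| = 2) :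
  is_copy T H f -> (forall v, f v \notin e) ->
  contains (e0_plus T) (add_first H he).
Proof.
move=> [finj fE fL] fe.
have /eqP/cards2P[a [b [ab eE]]] := he.
pose h (s : V + bool) :=
  match s with inl v => f v | inr false => a | inr true => b end.
have fa v : f v != a.
  by apply: contraNneq (fe v) => ->; rewrite eE !inE eqxx.
have fb v : f v != b.
  by apply: contraNneq (fe v) => ->; rewrite eE !inE eqxx orbT.
have he0 : h @: e0 V = e by rewrite imsetU1 imset_set1 eE.
have hl (e1 : {set V}) : h @: (inl @: e1) = f @: e1 by rewrite -imset_comp.
have fne e1 : e1 \in edges T -> (f @: e1 == e) = false.
  move=> /edges_card2 c2; apply/negbTE/negP=> /eqP fe1.
  have /card_gt0P[v ve] : 0 < #|e1| by rewrite c2.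
  by have := fe v; rewrite -fe1 imset_f.
have lne (e1 : {set V}) : (inl @: e1 == e0 V) = false.
  apply/negbTE/negP=> /eqP E.
  have : inr true \in e0 V by rewrite !inE.
  by rewrite -E => /imsetP[].
exists h; split.
- move=> [u|[]] [v|[]] //=; first by move/finj->.
  + by move=> E; case/eqP: (fb u).
  + by move=> E; case/eqP: (fa u).
  + by move=> E; case/eqP: (fb v).
  + by move=> E; case/eqP: ab.
  + by move=> E; case/eqP: (fa v).
  + by move=> E; case/eqP: ab.
- move=> _ /setU1P[->|/imsetP[e1 e1T ->]]; first by rewrite he0 setU11.
  by rewrite hl setU1r ?fE.
- move=> _ _ /setU1P[->|/imsetP[e1 e1T ->]] /setU1P[->|/imsetP[e2 e2T ->]];
    rewrite /= /add_first_label ?he0 ?hl ?eqxx ?fne ?lne //.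
  by rewrite /= /lift_label !inl_preimK !ltnS fL.
Qed.

(** As long as some insertion creates no copy of [e0_plus T], it is carried out. Each one lowers the
    number of non-edges, keeps the copies [phi i] and stays inside [C]; the final bound counts all
    subsets of [C]. *)
Lemma saturation (V W : finType) (T : eograph V) (I : finType)
    (phi : I -> V -> W) (C : {set W}) (H : eograph W) :
  (forall i, is_copy T H (phi i)) ->
  (forall u, exists i, forall v, phi i v != u) ->
  (forall i v, phi i v \in C) ->
  (forall e, e \in edges H -> e \subset C) ->
  ~ contains (e0_plus T) H ->
  exists2 H' : eograph W,
    saturated_m (e0_plus T) H' & #|edges H'| <= 2 ^ #|C|.
Proof.
move=> + noCommon phiC.
have [n] := ubnP (#|~: edges H|); elim: n H => // n IHn H ltn cH HC nH.
have [satH|nsat] := classic (saturated_m (e0_plus T) H).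
  exists H; rewrite // -card_powerset; apply: subset_leq_card.
  by apply/subsetP=> e /HC; rewrite powersetE.
have [e ee] : exists e : {set W}, ~ (forall he : #|e| = 2, e \notin edges H ->
    contains (e0_plus T) (add_first H he)).
  by apply: NNPP => nE; apply: nsat; split=> // e; apply: NNPP => ne; case: nE; exists e.
have [he {}ee] := not_all_ex_not _ _ ee.
have [eH nC] := imply_to_and _ _ ee.
apply: (IHn (add_first H he)) => //.
- rewrite -ltnS; apply: leq_trans ltn; rewrite ltnS.
  apply: proper_card; apply/properP; split.
    by apply/subsetP=> e'; rewrite !inE negb_or => /andP[].
  by exists e; rewrite !inE ?eqxx.
- by move=> i; apply: is_copy_add_first.
- move=> e' /setU1P[->|]; last exact: HC.
  (* otherwise a copy avoiding the other end of [e] avoids both ends *)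
  apply/negPn/negP=> /subsetPn[w we wC]; apply: nC.
  have /cards1P[u uE] : #|e :\ w| == 1 by have := cardsD1 w e; rewrite he we; lia.
  have [i iu] := noCommon u.
  apply: (contains_e0_plus_add_first he (cH i)) => v.
  rewrite -(setD1K we) uE !inE negb_or iu andbT.
  by apply: contraNneq wC => <-.
Qed.

Lemma is_sat_m_exists (V : finType) (n : nat) (G : eograph V)
    (H : eograph 'I_n) :
  saturated_m G H -> exists2 k, is_sat_m n G k & k <= #|edges H|.
Proof.
have [m] := ubnP #|edges H|; elim: m H => // m IHm H ltm sH.
have [[H' [sH' lt]]|nH] := classic (exists H' : eograph 'I_n,
    saturated_m G H' /\ #|edges H'| < #|edges H|).
  have [|k kS kle] := IHm H' _ sH'; first exact: leq_trans lt ltm.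
  by exists k => //; apply: leq_trans kle (ltnW lt).
exists #|edges H| => //; split; first by exists H.
move=> H' sH'; rewrite leqNgt; apply/negP=> lt.
by apply: nH; exists H'.
Qed.

(** * Ordering a union of copies *)

(* Edges of the union are ordered by the edge of [T] they come from, and
   arbitrarily among those coming from the same edge. *)
Lemma union_of_copies (V W I : finType) (T : eograph V) (phi : I -> V -> W) :
  (forall i, injective (phi i)) ->
  (forall i j, {in edges T &, forall e1 e2 : {set V},
     phi i @: e1 = phi j @: e2 -> e1 = e2}) ->
  exists H : eograph W,
    [/\ forall s, s \in edges H <->
          exists i, exists2 e, e \in edges T & s = phi i @: e,
        forall i, is_copy T H (phi i)
      & forall i j, {in edges T &, forall e1 e2 : {set V},
          label T e1 < label T e2 ->
          label H (phi i @: e1) < label H (phi j @: e2)}].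
Proof.
move=> phi_inj unamb.
pose E := \bigcup_i [set phi i @: (e : {set V}) | e in edges T].
pose lev s := if [pick e in edges T | [exists i, phi i @: e == s]] is Some e
              then label T e else 0.
(* Since the rank is below [#|{set W}|], this codes the lexicographic order of level and rank. *)
pose lab s := lev s * #|{set W}| + enum_rank s.
have EP s : s \in E <-> exists i, exists2 e, e \in edges T & s = phi i @: e.
  split=> [/bigcupP[i _ /imsetP[e eT ->]]|[i [e eT ->]]]; first by exists i, e.
  by apply/bigcupP; exists i => //; apply/imsetP; exists e.
have E2 s : s \in E -> #|s| = 2.
  by case/EP=> i [e /edges_card2 e2 ->]; rewrite card_imset.
have lab_inj : {in E &, injective lab}.
  move=> s s' _ _ /(congr1 (modn^~ #|{set W}|)); rewrite !modnMDl.
  rewrite !modn_small ?ltn_ord // => /ord_inj; exact: enum_rank_inj.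
have levE i e : e \in edges T -> lev (phi i @: e) = label T e.
  move=> eT; rewrite /lev; case: pickP => [e' /andP[e'T /existsP[j /eqP jE]]|].
    by rewrite (unamb j i e' e).
  by move=> /(_ e); rewrite eT /= => /existsP[]; exists i.
have mono i j : {in edges T &, forall e1 e2 : {set V},
    label T e1 < label T e2 -> lab (phi i @: e1) < lab (phi j @: e2)}.
  move=> e1 e2 e1T e2T lt; rewrite /lab !levE //.
  apply: leq_trans (leq_addr _ _); apply: leq_trans (leq_mul lt (leqnn _)).
  by rewrite mulSn addnC ltn_add2r ltn_ord.
exists (EOGraph E2 lab_inj); split=> // i; split=> //.
  by move=> e eT; apply/EP; exists i, e.
move=> e1 e2 e1T e2T /=.
case: (ltngtP (label T e1) (label T e2)) => [lt|lt|eq].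
- exact: mono.
- by apply/negbTE; rewrite -leqNgt ltnW ?mono.
- by rewrite (label_inj e1T e2T eq) ltnn.
Qed.

(** * The three layers on a triangle *)

(** The sides are the component of [x] after removal of the edge and its complement. A path from [x]
    to [y] left over would close up to a cycle through that edge. *)
Lemma tree_split (V : finType) (T : eograph V) (x y : V) :
  is_tree T -> [set x; y] \in edges T ->
  exists side : V -> bool,
    [/\ side x = false, side y = true
      & forall u v, [set u; v] \in edges T -> [set u; v] != [set x; y] ->
          side u = side v].
Proof.
move=> [_ _ acyclic] xyT.
have xy : x != y.
  by apply: contraTneq xyT => ->; apply/negP=> /edges_card2; rewrite setUid cards1.
pose adj' := [rel u v | ([set u; v] \in edges T) && ([set u; v] != [set x; y])].
have sym' : connect_sym adj'.
  by apply: sym_connect_sym => u v; rewrite /= setUC.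
have nxy : ~~ connect adj' x y.
  apply/negP=> /connectP[p0 p0p yE].
  case/shortenP: p0p yE => p pp pU _ yE.
  have : ucycle (adj T) (x :: p).
    have yx : adj T y x by rewrite /adj /= setUC.
    rewrite /ucycle pU andbT /= rcons_path -yE yx andbT.
    by apply: sub_path pp => u v /andP[].
  move/acyclic; case: p pp yE {pU} => [_ /= E|z [|//]].
    by rewrite E eqxx in xy.
  by move=> /= /andP[/andP[_ zy] _] E; rewrite E eqxx in zy.
exists (fun z => ~~ connect adj' x z); rewrite connect0; split=> // u v uvT uvf.
by congr negb; apply: (same_connect_r sym'); apply: connect1; rewrite /= uvT.
Qed.

Lemma ordS3_neq (i : 'I_3) : ordS i != i.
Proof. by case: i => [[|[|[|//]]] ?]. Qed.

(** Copy [i] only uses the layers [i] and [ordS i], so each layer is missed by some copy. *)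
Lemma ordS3_avoid (k : 'I_3) : exists i : 'I_3, (i != k) && (ordS i != k).
Proof.
by exists (ordS k); case: k => [[|[|[|//]]] ?].
Qed.

Lemma ordS3_meet (i j : 'I_3) : [|| i == j, ordS i == j | i == ordS j].
Proof.
by case: i => [[|[|[|//]]] ?]; case: j => [[|[|[|//]]] ?].
Qed.

Lemma saturated_core (V W : finType) (T : eograph V) (f : {set V})
    (psi : V * 'I_3 -> W) :
  is_tree T -> f \in edges T ->
  {in edges T, forall e : {set V}, label T f <= label T e} ->
  injective psi ->
  exists2 H : eograph W,
    saturated_m (e0_plus T) H & #|edges H| <= 2 ^ (#|V| * 3).
Proof.
move=> treeT fT fmin psi_inj.
have /eqP/cards2P[x [y [xy fE]]] := edges_card2 fT; subst f.
have [side [sx sy sideE]] := tree_split treeT fT.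
have hung e : e \in edges T -> e != [set x; y] ->
    {in e &, forall u v, side u = side v}.
  move=> eT ef u v; have /eqP/cards2P[a [b [ab eE]]] := edges_card2 eT; subst e.
  have E := sideE _ _ eT ef.
  by rewrite !inE => /orP[]/eqP-> /orP[]/eqP->.
(* [psi (z, k)] is the vertex [z] of layer [k]; [psi (y, k)] stays isolated *)
pose glue z := if z == y then x else z.
(* Only [x] and [y] are identified, and they lie on different sides. *)
have glue_inj u v : side u = side v -> glue u = glue v -> u = v.
  rewrite /glue; case: eqP => [->|_]; case: eqP => [->|_] // + E.
    by rewrite -E sx sy.
  by rewrite E sx sy.
have glue_y z : glue z != y by rewrite /glue; case: ifPn.
pose lay (i : 'I_3) z := if side z then ordS i else i.
pose phi i z := psi (glue z, lay i z).
have phiE i j u v : phi i u = phi j v -> glue u = glue v /\ lay i u = lay j v.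
  by move/psi_inj=> [].
have lay_side i u v : lay i u = lay i v -> side u = side v.
  rewrite /lay; have := ordS3_neq i.
  by case: (side u); case: (side v) => // /eqP n E; case: n.
have phi_inj i : injective (phi i).
  by move=> u v /phiE[gE /lay_side sE]; apply: glue_inj.
have im_f i : phi i @: [set x; y] = [set psi (x, i); psi (x, ordS i)].
  by rewrite imsetU1 imset_set1 /phi /glue /lay sx sy eqxx (negbTE xy).
(* A triangle edge joins two layers; the image of any other edge lies in one. *)
have f_hung i j e : e \in edges T -> e != [set x; y] ->
    phi i @: [set x; y] <> phi j @: e.
  move=> eT ef E.
  have : phi i x \in phi j @: e by rewrite -E imset_f // !inE eqxx.
  have : phi i y \in phi j @: e by rewrite -E imset_f // !inE eqxx orbT.
  move=> /imsetP[v ve /phiE[_ lv]] /imsetP[u ue /phiE[_ lu]].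
  have : side x = side y.
    by apply: (lay_side i); rewrite lu lv /lay (hung e eT ef u v).
  by rewrite sx sy.
have unamb i j : {in edges T &, forall e1 e2 : {set V},
    phi i @: e1 = phi j @: e2 -> e1 = e2}.
  move=> e1 e2 e1T e2T E.
  have [e1f|e1f] := eqVneq e1 [set x; y].
    have [->//|e2f] := eqVneq e2 [set x; y].
    by case: (f_hung i j e2 e2T e2f); rewrite -e1f.
  have [e2f|e2f] := eqVneq e2 [set x; y].
    by case: (f_hung j i e1 e1T e1f); rewrite -e2f.
  have pre u : u \in e1 -> exists2 v, v \in e2 & phi i u = phi j v.
    by move=> ue; apply/imsetP; rewrite -E imset_f.
  have [p pe pf] : exists2 p, p \in e1 & p \notin [set x; y].
    apply/subsetPn; apply: contra e1f => sub.
    by rewrite eqEcard sub (edges_card2 e1T) (edges_card2 fT).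
  (* [p] is untouched by the gluing, so its preimage in [e2] is [p] itself *)
  have pe2 : p \in e2.
    have [q qe /phiE[gE _]] := pre p pe.
    move: pf gE; rewrite !inE negb_or => /andP[/negbTE px /negbTE py].
    rewrite /glue py; case: eqP => [_ pE|_ -> //].
    by rewrite pE eqxx in px.
  apply/eqP; rewrite eqEcard (edges_card2 e1T) (edges_card2 e2T) andbT.
  apply/subsetP=> u ue; have [v ve /phiE[gE _]] := pre u ue.
  suff -> : u = v by [].
  (* Both [u] and [v] lie on the side of [p], through [e1] and [e2] respectively. *)
  by apply: glue_inj gE; rewrite (hung e1 _ _ u p) // (hung e2 _ _ v p).
have [H [HE Hcopy Hmono]] := union_of_copies phi_inj unamb.
have [|||||K KS Kle] := @saturation _ _ T _ phi (psi @: setT) H.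
- exact: Hcopy.
- move=> u; have [uim|uim] := boolP (u \in codom psi); last first.
    exists ord0 => v; apply: contraNneq uim => <-; exact: codom_f.
  have /codomP[[a k] ->] := uim.
  have [i /andP[ik Sik]] := ordS3_avoid k.
  exists i => v; apply/eqP=> /psi_inj[_]; rewrite /lay.
  by case: ifP => _ E; [rewrite E eqxx in Sik|rewrite E eqxx in ik].
- by move=> i v; apply: imset_f.
- move=> s /HE[i [e _ ->]]; apply/subsetP=> _ /imsetP[v _ ->].
  exact: imset_f.
- move=> [h [hinj hE hL]].
  have e0T : e0 V \in edges (e0_plus T) by rewrite setU11.
  have liftT (e : {set V}) : e \in edges T -> inl @: e \in edges (e0_plus T).
    by move=> eT; rewrite setU1r ?imset_f.
  pose g v := h (inl v).
  have gE (e : {set V}) : h @: (inl @: e) = g @: e by rewrite -imset_comp.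
  have lt0 (e : {set V}) : e \in edges T -> label H (h @: e0 V) < label H (g @: e).
    move=> eT; rewrite -gE hL ?liftT //= /add_first_label eqxx.
    case: eqP => // E; have : inr true \in e0 V by rewrite !inE.
    by rewrite -E => /imsetP[].
  have dis v : g v \notin h @: e0 V.
    by rewrite /g mem_imset // !inE.
  (* If the image of [e0] is a triangle edge, it would meet this one; if not, it comes after all
     triangle edges. *)
  have not_f (e : {set V}) j : e \in edges T -> g @: e <> phi j @: [set x; y].
    move=> eT E.
    have [i [e1 e1T e1E]] := (HE _).1 (hE _ e0T).
    have := lt0 _ eT; rewrite E e1E.
    have [e1f|e1f] := eqVneq e1 [set x; y].
      (* any two triangle edges meet *)
      move=> _.
      have [w] : exists w, w \in (phi i @: [set x; y]) :&: (phi j @: [set x; y]).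
        rewrite !im_f; case/or3P: (ordS3_meet i j) => /eqP ij.
        - by exists (psi (x, i)); rewrite !inE -ij eqxx.
        - by exists (psi (x, j)); rewrite !inE -ij eqxx orbT.
        - by exists (psi (x, i)); rewrite !inE -ij eqxx orbT.
      rewrite inE -E => /andP[+ /imsetP[v _ wE]].
      by rewrite wE -e1f -e1E (negbTE (dis v)).
    rewrite ltnNge ltnW // Hmono // ltn_neqAle fmin // andbT.
    by apply: contra e1f => /eqP/label_inj->.
  (* Layer [k] without its isolated vertex. Each edge of [g] stays inside one such set, hence by
     connectedness so does all of [g], but there are only [#|V| - 1] vertices in it. *)
  pose L k := [set psi (z, k) | z in [set~ y]].
  have gL u v : adj T u v -> exists k, (g u \in L k) && (g v \in L k).
    move=> uvT; have [j [e eT eE]] := (HE _).1 (hE _ (liftT _ uvT)).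
    have ef : e != [set x; y].
      by apply/eqP=> ef; apply: (not_f _ j uvT); rewrite -gE eE ef.
    rewrite gE in eE.
    have: g u \in phi j @: e by rewrite -eE imset_f // !inE eqxx.
    have: g v \in phi j @: e by rewrite -eE imset_f // !inE eqxx orbT.
    move=> /imsetP[b be ->] /imsetP[a ae ->]; exists (lay j a).
    rewrite /phi [lay j b](_ : _ = lay j a).
      by rewrite !imset_f // !inE glue_y.
    by rewrite /lay (hung e eT ef a b).
  have Ldis k k' w : w \in L k -> w \in L k' -> k = k'.
    by move=> /imsetP[a _ ->] /imsetP[b _ /psi_inj[]].
  have [k xk] : exists k, g x \in L k.
    by have [k /andP[xk _]] := gL x y fT; exists k.
  have [_ conT _] := treeT.
  have allL v : g v \in L k.
    have /connectP[p + ->] := conT x v.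
    elim: p (x) xk => [|z p IHp] w wk //= /andP[wz pz].
    have [k' /andP[wk' zk']] := gL w z wz.
    by apply: IHp => //; rewrite (Ldis k k' (g w)).
  have : #|g @: [set: V]| <= #|L k|.
    by apply/subset_leq_card/subsetP=> _ /imsetP[v _ ->].
  rewrite card_imset; last by move=> u v /hinj[].
  rewrite card_imset; last by move=> u v /psi_inj[].
  by rewrite cardsT cardsC1; have := max_card (pred1 x); rewrite card1; lia.
exists K => //; apply: leq_trans Kle _.
by rewrite leq_exp2l // card_imset // cardsT card_prod card_ord.
Qed.

Theorem corollary40 (V : finType) (T : eograph V) (hT : is_tree T) :
  exists C N : nat, forall n : nat, N <= n ->
    exists2 k : nat, is_sat_m n (e0_plus T) k & k <= C.
Proof.
(* [#|V| * 3] vertices make room for three layers indexed by [V]. *)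
exists (2 ^ (#|V| * 3)), (#|V| * 3) => n Nn.
suff [H HS Hle] : exists2 H : eograph 'I_n,
    saturated_m (e0_plus T) H & #|edges H| <= 2 ^ (#|V| * 3).
  have [k kS kle] := is_sat_m_exists HS.
  by exists k => //; apply: leq_trans kle Hle.
have cardV : #|{: V * 'I_3}| = #|V| * 3 by rewrite card_prod card_ord.
have le : #|{: V * 'I_3}| <= n by rewrite cardV.
pose psi (z : V * 'I_3) := widen_ord le (enum_rank z).
have psi_inj : injective psi.
  by move=> z z' [] /ord_inj/enum_rank_inj.
have [f0 f0T|noT] := pickP (mem (edges T)).
  have [f fT fmin] := arg_minnP (label T) f0T.
  exact: (saturated_core hT fT fmin psi_inj).
(* With no edge to contract, three disjoint copies of [T] in an edgeless graph do; [e0] has no image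
   there. *)
have T0 e : e \in edges T = false by exact: noT.
pose phi (i : 'I_3) v := psi (v, i).
have phi_inj i : injective (phi i) by move=> u v /psi_inj[].
have unamb i j : {in edges T &, forall e1 e2 : {set V},
  phi i @: e1 = phi j @: e2 -> e1 = e2} by move=> e1 e2; rewrite T0.
have [H [HE Hcopy _]] := union_of_copies phi_inj unamb.
have H0 s : s \notin edges H by apply/negP=> /HE[i [e]]; rewrite T0.
have [|||||K KS Kle] := @saturation _ _ T _ phi (psi @: setT) H.
- exact: Hcopy.
- move=> u; have [/codomP[[a k] ->]|uim] := boolP (u \in codom psi).
    exists (ordS k) => v; apply/eqP=> /psi_inj[_ /eqP].
    by rewrite (negbTE (ordS3_neq k)).
  by exists ord0 => v; apply: contraNneq uim => <-; exact: codom_f.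
- by move=> i v; apply: imset_f.
- by move=> s; rewrite (negbTE (H0 s)).
- move=> [h [_ hE _]].
  by have := H0 (h @: e0 V); rewrite hE // setU11.
by exists K => //; apply: leq_trans Kle _; rewrite card_imset // cardsT cardV.
Qed.
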